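(* Let $\{C_k\}_{k\ge 0},\{D_k\}_{k\ge 0},\{Y_k\}_{k\ge 0},\{\mu_k\}_{k\ge 0}$ be the sequences generated by the WSVT iteration (defined in the context) for a data matrix $X\in\mathbb{R}^{m\times n}$, a non-singular weight matrix $W\in\mathbb{R}^{n\times n}$, and parameters $\tau>0$, $\rho>1$, $\mu_0>0$. Then the following hold. (i) The sequences $\{C_k\}$ and $\{D_k\}$ are convergent. Moreover, there is a constant $C$ independent of $k$ such that $$\|D_k-C_kW^{-1}\|\le \frac{C}{\mu_k},\qquad k=1,2,\dots.$$ (ii) Let $L_{k+1}:=L(C_{k+1},D_{k+1},Y_k,\mu_k)$ for $k\ge 0$, where $L$ is the augmented Lagrangian defined in the context. Then the sequence $\{L_k\}_{k\ge 1}$ is bounded above and $$L_{k+1}-L_k\le \frac{\mu_k+\mu_{k-1}}{2}\|D_k-C_kW^{-1}\|_F^2=O\!\left(\frac{1}{\mu_k}\right),\qquad k=1,2,\dots.$$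
   Context: $\|\cdot\|_F$ is the Frobenius norm, $\|\cdot\|_*$ the nuclear norm (sum of singular values), $\langle A,B\rangle=\mathrm{tr}(A^TB)$. An unsubscripted $\|\cdot\|$ is any fixed matrix norm, e.g. the Frobenius norm (all norms on $\mathbb{R}^{m\times n}$ are equivalent). $O(1/\mu_k)$ denotes a quantity bounded in absolute value by a constant independent of $k$ times $1/\mu_k$. Augmented Lagrangian: for $C,D,Y\in\mathbb{R}^{m\times n}$ and $\mu>0$, $$L(C,D,Y,\mu)=\tfrac12\|XW-C\|_F^2+\tau\|D\|_*+\langle Y,D-CW^{-1}\rangle+\tfrac{\mu}{2}\|D-CW^{-1}\|_F^2 .$$ WSVT iteration: initialize $C_0=XW$, $D_0=X$, $Y_0=0$, $\mu_0>0$. For $k=0,1,2,\dots$ set $$C_{k+1}=\arg\min_C L(C,D_k,Y_k,\mu_k)=\big(XW+\mu_kD_k(W^{-1})^T+Y_k(W^{-1})^T\big)\big(I_n+\mu_k(W^TW)^{-1}\big)^{-1},$$ $$D_{k+1}=\arg\min_D L(C_{k+1},D,Y_k,\mu_k)=U_kS_{\tau/\mu_k}(\Sigma_k)V_k^T,$$ where $U_k\Sigma_kV_k^T$ is a singular value decomposition of $C_{k+1}W^{-1}-\frac1{\mu_k}Y_k$ and $S_t(x)=\mathrm{sign}(x)\max(|x|-t,0)$ is applied entrywise; and $$Y_{k+1}=Y_k+\mu_k(D_{k+1}-C_{k+1}W^{-1}),\qquad \mu_{k+1}=\rho\mu_k .$$ The iteration is run indefinitely (no stopping criterion). *)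

(* Defs.v *)
From HB Require Import structures.
From mathcomp Require Import all_boot all_order all_algebra.
From mathcomp Require polyrcf.
From mathcomp Require Import all_classical all_reals all_analysis.

Set Implicit Arguments.
Unset Strict Implicit.
Unset Printing Implicit Defensive.

Import Order.TTheory GRing.Theory Num.Theory.
Import numFieldNormedType.Exports.

Local Open Scope ring_scope.

Section MatrixNorms.
Context {R : realType} {m n : nat}.
Implicit Types A B : 'M[R]_(m, n).

Record is_norm (N : 'M[R]_(m, n) -> R) : Prop := IsNorm {
  is_norm_triangle : forall A B, N (A + B) <= N A + N B;
  is_norm_scale : forall (a : R) A, N (a *: A) = `|a| * N A;
  is_norm_eq0 : forall A, N A = 0 -> A = 0
}.

Definition frob_inner A B : R := \tr (A^T *m B).

Definition frob A : R := Num.sqrt (frob_inner A A).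

(* The singular values of A are the square roots of the eigenvalues of A^T A,
   counted with multiplicity. As A^T A is n x n, they come with extra zeros
   when m < n. [rootsR] lists each real root once, hence the factor [mup x p];
   all the roots of this polynomial are real and nonnegative. *)
Definition nuclear_norm A : R :=
  let p := char_poly (A^T *m A) in
  \sum_(x <- polyrcf.rootsR p) Num.sqrt x *+ mup x p.

(* Full-size SVD; the order of the diagonal entries of S is not prescribed. *)
Record is_svd A (U : 'M[R]_m) (S : 'M[R]_(m, n)) (V : 'M[R]_n) : Prop := IsSvd {
  is_svd_eq : A = U *m S *m V^T;
  is_svd_orthl : U^T *m U = 1%:M;
  is_svd_orthr : V^T *m V = 1%:M;
  is_svd_diag : forall (i : 'I_m) (j : 'I_n), (i : nat) <> j -> S i j = 0;
  is_svd_ge0 : forall i j, 0 <= S i j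
}.

End MatrixNorms.

Definition soft_threshold {R : realType} (t x : R) : R :=
  Num.sg x * Num.max (`|x| - t) 0.

Section WSVT.
Context {R : realType} {m n : nat}.
Variables (X : 'M[R]_(m, n)) (W : 'M[R]_n) (tau : R).

Definition aug_lagrangian (C D Y : 'M[R]_(m, n)) (mu : R) : R :=
  2^-1 * frob (X *m W - C) ^+ 2 + tau * nuclear_norm D
  + frob_inner Y (D - C *m invmx W)
  + mu / 2 * frob (D - C *m invmx W) ^+ 2.

(* The updates of C and D are the closed forms of
     argmin_C L(C, D_k, Y_k, mu_k) and argmin_D L(C_{k+1}, D, Y_k, mu_k);
   their minimality is a consequence, not a hypothesis. The update of D holds
   for some SVD; the resulting matrix does not depend on which one. *)
Record wsvt (rho mu0 : R) (C D Y : nat -> 'M[R]_(m, n)) (mu : nat -> R)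
    : Prop := Wsvt {
  wsvt_C0 : C 0%N = X *m W;
  wsvt_D0 : D 0%N = X;
  wsvt_Y0 : Y 0%N = 0;
  wsvt_mu0 : mu 0%N = mu0;
  wsvt_CS : forall k, C k.+1 =
    (X *m W + mu k *: (D k *m (invmx W)^T) + Y k *m (invmx W)^T)
      *m invmx (1%:M + mu k *: invmx (W^T *m W));
  wsvt_DS : forall k, exists U S V,
    is_svd (C k.+1 *m invmx W - (mu k)^-1 *: Y k) U S V /\
    D k.+1 = U *m map_mx (soft_threshold (tau / mu k)) S *m V^T;
  wsvt_YS : forall k, Y k.+1 = Y k + mu k *: (D k.+1 - C k.+1 *m invmx W);
  wsvt_muS : forall k, mu k.+1 = rho * mu k
}.

End WSVT.

(* Main.v *)
Require Import Defs.
From HB Require Import structures.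
From mathcomp Require Import all_boot all_order all_algebra.
From mathcomp Require Import all_classical all_reals all_analysis.
From mathcomp Require Import polyrcf complex ring lra.

Import Order.TTheory GRing.Theory Num.Theory.
Import numFieldNormedType.Exports.

Local Open Scope classical_set_scope.
Local Open Scope ring_scope.

(** Three facts carry the proof; write E for the inverse of W and r_k for the
    gap D_k - C_k E.

    The multipliers are bounded. If A = C_{k+1} E - Y_k / mu_k has the singular
    value decomposition U S V^T, then Y_{k+1} = - mu_k (A - D_{k+1}), and
    A - D_{k+1} = U T V^T where T truncates the entries of S at tau / mu_k.
    Hence |Y_{k+1}|_F <= sqrt (m n) tau, whatever A is ([svt_residual],
    [frob_Y_le]). As r_{k+1} = (Y_{k+1} - Y_k) / mu_k, the gap is O(1 / mu_k)
    ([frob_gap_le]).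

    The increments of C are O(1 / mu_k). The update of C rearranges into
      (C_{k+1} - C_k) (I + mu_k E E^T)
        = X W + Y_k E^T + mu_k r_k E^T - C_k,
    where everything on the right but C_k is already known to be bounded, and
    the inverse of I + mu_k E E^T has norm at most |W|_F^2 / mu_k
    ([frob_resolvent]). So |C_{k+1}|_F + b <= (1 + a / mu_k) (|C_k|_F + b) for
    some constants a and b; as 1 / mu_k is geometric, the product of these
    factors converges, C is bounded, and its increments are dominated by a
    geometric sequence. The increments of D = C E + r are then dominated in the
    same way, and both sequences converge entrywise.

    Both updates decrease the augmented Lagrangian, so L_{k+1} is at most its
    value at (C_k, D_k, Y_k, mu_k), which exceeds L_k by exactly
      <Y_k - Y_{k-1}, r_k> + (mu_k - mu_{k-1}) / 2 |r_k|_F^2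
        = (mu_k + mu_{k-1}) / 2 |r_k|_F^2.
    This is O(1 / mu_k), hence summable, hence L is bounded above.
    For C the minimality is that of a stationary point of a convex quadratic
    ([aug_lagrangian_minC]). For D ([aug_lagrangian_minD]) it says that
    A - D_{k+1} is a subgradient of (tau / mu_k) |.|_* at D_{k+1}. This needs
    the duality between the nuclear norm and the spectral norm: if the singular
    values of P are at most t, then <P, D> <= t |D|_* ([frob_inner_le_nuclear]).
    Over an orthonormal eigenbasis q_j of D^T D, with eigenvalues l_j,
      <P, D> = sum_j <P q_j, D q_j> <= sum_j |P q_j| |D q_j|
             <= t sum_j sqrt l_j = t |D|_*.
    The eigenbasis is a complex one, obtained from the spectral theorem for
    Hermitian matrices. *)

Set Implicit Arguments.
Unset Strict Implicit.

(** * The Frobenius inner product *)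

Section Frobenius.
Context {R : realType}.

Lemma frob_innerE m n (A B : 'M[R]_(m, n)) :
  frob_inner A B = \sum_i \sum_j A i j * B i j.
Proof.
rewrite /frob_inner /mxtrace exchange_big /=; apply: eq_bigr => j _.
by rewrite mxE; apply: eq_bigr => i _; rewrite mxE.
Qed.

Lemma frob_innerC m n (A B : 'M[R]_(m, n)) : frob_inner A B = frob_inner B A.
Proof.
by rewrite !frob_innerE; do 2!apply: eq_bigr => ? _; rewrite mulrC.
Qed.

Lemma frob_innerDl m n (A B D : 'M[R]_(m, n)) :
  frob_inner (A + B) D = frob_inner A D + frob_inner B D.
Proof. by rewrite /frob_inner linearD mulmxDl linearD. Qed.

Lemma frob_innerZl m n a (A D : 'M[R]_(m, n)) :
  frob_inner (a *: A) D = a * frob_inner A D.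
Proof. by rewrite /frob_inner linearZ -scalemxAl linearZ. Qed.

Lemma frob_innerNl m n (A D : 'M[R]_(m, n)) :
  frob_inner (- A) D = - frob_inner A D.
Proof. by rewrite -scaleN1r frob_innerZl mulN1r. Qed.

Lemma frob_innerDr m n (A B D : 'M[R]_(m, n)) :
  frob_inner D (A + B) = frob_inner D A + frob_inner D B.
Proof. by rewrite !(frob_innerC D) frob_innerDl. Qed.

Lemma frob_innerZr m n a (A D : 'M[R]_(m, n)) :
  frob_inner D (a *: A) = a * frob_inner D A.
Proof. by rewrite !(frob_innerC D) frob_innerZl. Qed.

Lemma frob_innerNr m n (A D : 'M[R]_(m, n)) :
  frob_inner D (- A) = - frob_inner D A.
Proof. by rewrite !(frob_innerC D) frob_innerNl. Qed.

Definition frob_inner_linear := (frob_innerDl, frob_innerDr, frob_innerNl,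
  frob_innerNr, frob_innerZl, frob_innerZr).

Lemma frob_inner_mulmxr m n p (A : 'M[R]_(m, n)) (B : 'M[R]_(n, p)) D :
  frob_inner (A *m B) D = frob_inner A (D *m B^T).
Proof. by rewrite /frob_inner trmx_mul -mulmxA mxtrace_mulC mulmxA. Qed.

Lemma frob_inner_ge0 m n (A : 'M[R]_(m, n)) : 0 <= frob_inner A A.
Proof.
rewrite frob_innerE !sumr_ge0// => i _.
by rewrite sumr_ge0// => j _; exact: sqr_ge0.
Qed.

Lemma sqr_frob m n (A : 'M[R]_(m, n)) : frob A ^+ 2 = frob_inner A A.
Proof. by rewrite sqr_sqrtr ?frob_inner_ge0. Qed.

Lemma frob_ge0 m n (A : 'M[R]_(m, n)) : 0 <= frob A.
Proof. exact: sqrtr_ge0. Qed.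

Lemma frob_le m n (A : 'M[R]_(m, n)) c :
  0 <= c -> frob_inner A A <= c ^+ 2 -> frob A <= c.
Proof. by move=> c0 Ac; rewrite -(ger0_norm c0) -sqrtr_sqr ler_wsqrtr. Qed.

Lemma normr_coef_le_frob m n (A : 'M[R]_(m, n)) i j : `|A i j| <= frob A.
Proof.
rewrite -sqrtr_sqr ler_wsqrtr// frob_innerE (bigD1 i)//= (bigD1 j)//=.
rewrite -addrA lerDl addr_ge0 ?sumr_ge0// => [k _|k _]; first exact: sqr_ge0.
by rewrite sumr_ge0// => l _; exact: sqr_ge0.
Qed.

Lemma frob_eq0 m n (A : 'M[R]_(m, n)) : frob A = 0 -> A = 0.
Proof.
move=> A0; apply/matrixP => i j; rewrite mxE; apply/eqP.
by rewrite -normr_le0 -A0 normr_coef_le_frob.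
Qed.

Lemma frobZ m n a (A : 'M[R]_(m, n)) : frob (a *: A) = `|a| * frob A.
Proof.
by rewrite /frob !frob_inner_linear mulrA -expr2 sqrtrM ?sqr_ge0// sqrtr_sqr.
Qed.

Lemma frob0 m n : frob (0 : 'M[R]_(m, n)) = 0.
Proof. by rewrite -(scale0r 0) frobZ normr0 mul0r. Qed.

Lemma frobN m n (A : 'M[R]_(m, n)) : frob (- A) = frob A.
Proof. by rewrite -scaleN1r frobZ normrN1 mul1r. Qed.

(** Cauchy-Schwarz, by expanding the square norm of |B| A - |A| B. *)
Lemma frob_inner_le m n (A B : 'M[R]_(m, n)) :
  frob_inner A B <= frob A * frob B.
Proof.
have [/frob_eq0->|B0] := eqVneq (frob B) 0.
  by rewrite /frob_inner mulmx0 linear0 mulr_ge0 ?frob_ge0.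
have Bgt0 : 0 < frob B by rewrite lt_neqAle eq_sym B0 frob_ge0.
have [/frob_eq0->|A0] := eqVneq (frob A) 0.
  by rewrite /frob_inner linear0 mul0mx linear0 mulr_ge0 ?frob_ge0.
have Agt0 : 0 < frob A by rewrite lt_neqAle eq_sym A0 frob_ge0.
have := frob_inner_ge0 (frob B *: A - frob A *: B).
rewrite !frob_inner_linear (frob_innerC B A) -!sqr_frob => H.
have : 0 <= 2 * (frob A * frob B) * (frob A * frob B - frob_inner A B) by lra.
by rewrite pmulr_rge0 ?subr_ge0// !mulr_gt0.
Qed.

Lemma normr_frob_inner_le m n (A B : 'M[R]_(m, n)) :
  `|frob_inner A B| <= frob A * frob B.
Proof.
rewrite ler_norml frob_inner_le andbT lerNl -frob_innerNl.
by rewrite -[frob A]frobN frob_inner_le.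
Qed.

Lemma frobD m n (A B : 'M[R]_(m, n)) : frob (A + B) <= frob A + frob B.
Proof.
apply: frob_le; first by rewrite addr_ge0 ?frob_ge0.
rewrite !frob_inner_linear (frob_innerC B A) -!sqr_frob.
by have := frob_inner_le A B; lra.
Qed.

Lemma sqr_frobD m n (A B : 'M[R]_(m, n)) :
  frob (A + B) ^+ 2 = frob A ^+ 2 + 2 * frob_inner A B + frob B ^+ 2.
Proof. by rewrite !sqr_frob !frob_inner_linear (frob_innerC B A); ring. Qed.

Lemma frobM m n p (A : 'M[R]_(m, n)) (B : 'M[R]_(n, p)) :
  frob (A *m B) <= frob A * frob B.
Proof.
apply: frob_le; first by rewrite mulr_ge0 ?frob_ge0.
rewrite exprMn !sqr_frob !frob_innerE.
rewrite [X in _ <= _ * X]exchange_big/= mulr_suml ler_sum// => i _.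
rewrite mulr_sumr ler_sum// => j _.
(* the entry (i, j) is the inner product of row i of A and column j of B *)
have inE (u v : 'rV[R]_n) : frob_inner u v = \sum_k u 0 k * v 0 k.
  by rewrite frob_innerE big_ord1.
have -> : (A *m B) i j = frob_inner (row i A) (col j B)^T.
  by rewrite inE mxE; apply: eq_bigr => k _; rewrite !mxE.
have -> : \sum_k A i k * A i k = frob (row i A) ^+ 2.
  by rewrite sqr_frob inE; apply: eq_bigr => k _; rewrite !mxE.
have -> : \sum_k B k j * B k j = frob (col j B)^T ^+ 2.
  by rewrite sqr_frob inE; apply: eq_bigr => k _; rewrite !mxE.
rewrite -expr2 -exprMn -real_normK ?num_real//.
by rewrite ler_sqr ?nnegrE ?mulr_ge0 ?frob_ge0// normr_frob_inner_le.
Qed.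

End Frobenius.

(** * The nuclear norm *)

Lemma mup_prod_XsubC (F : fieldType) (s : seq F) x :
  mup x (\prod_(a <- s) ('X - a%:P)) = count_mem x s.
Proof.
elim: s => [|a s IH]; first by rewrite big_nil mupNroot// root1.
rewrite big_cons mupM ?polyXsubC_eq0 ?monic_neq0 ?monic_prod_XsubC// IH /=.
by rewrite -[X in mup _ X]expr1 mup_XsubCX; case: eqP.
Qed.

Lemma char_poly_diag (F : comNzRingType) n (d : 'rV[F]_n) :
  char_poly (diag_mx d) = \prod_j ('X - (d 0 j)%:P).
Proof.
rewrite char_poly_trig ?diag_mx_is_trig//.
by apply: eq_bigr => j _; rewrite mxE eqxx mulr1n.
Qed.

Lemma char_poly_conj (F : comNzRingType) n (P Q A : 'M[F]_n) :
  P *m Q = 1%:M -> char_poly (P *m A *m Q) = char_poly A.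
Proof.
move=> PQ; rewrite /char_poly.
have PQc : map_mx polyC P *m map_mx polyC Q = 1%:M.
  by rewrite -map_mxM PQ map_mx1.
have -> : char_poly_mx (P *m A *m Q) =
    map_mx polyC P *m char_poly_mx A *m map_mx polyC Q.
  rewrite /char_poly_mx !map_mxM mulmxBr mulmxBl; congr (_ - _).
  by rewrite scalar_mxC -mulmxA PQc mulmx1.
by rewrite !det_mulmx mulrAC -det_mulmx PQc det1 mul1r.
Qed.

(** The definition lists the distinct real roots of the characteristic
    polynomial with their multiplicities; once the polynomial is split, this
    is the list of its linear factors grouped by value. *)
Lemma nuclear_normE (R : realType) m n (A : 'M[R]_(m, n)) (d : 'I_n -> R) :
  char_poly (A^T *m A) = \prod_j ('X - (d j)%:P) ->
  nuclear_norm A = \sum_j Num.sqrt (d j).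
Proof.
rewrite /nuclear_norm => ->.
pose s := [seq d j | j <- enum 'I_n].
have -> : \prod_j ('X - (d j)%:P) = \prod_(a <- s) ('X - a%:P).
  by rewrite big_map big_enum.
have -> : \sum_j Num.sqrt (d j) = \sum_(a <- s) Num.sqrt a.
  by rewrite big_map big_enum.
have p0 : \prod_(a <- s) ('X - a%:P) != 0.
  by rewrite monic_neq0// monic_prod_XsubC.
rewrite (eq_bigr (fun x => Num.sqrt x *+ count_mem x s)); last first.
  by move=> x _; congr (_ *+ _); exact: (@mup_prod_XsubC R).
rewrite (perm_big (undup s)); last first.
  apply: uniq_perm; [exact: uniq_roots | exact: undup_uniq | move=> x].
  by rewrite mem_undup -(roots_on_rootsR p0) in_itv /= root_prod_XsubC.
by rewrite -[RHS]big_undup_iterop_count; apply: eq_bigr.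
Qed.

(** Rectangular diagonal matrices *)
(** The shape that [is_svd] requires of its middle factor, named because it
    also holds of the thresholded factor and of what the threshold removes. *)
Definition rdiag {F : nmodType} {m n : nat} (S : 'M[F]_(m, n)) :=
  forall (i : 'I_m) (j : 'I_n), (i : nat) <> j -> S i j = 0.

Lemma gram_rdiag (F : comNzRingType) m n (S : 'M[F]_(m, n)) : rdiag S ->
  S^T *m S = diag_mx (\row_j \sum_i S i j ^+ 2).
Proof.
move=> Sd; apply/matrixP => j k; rewrite !mxE; case: eqVneq => [->|jk].
  by rewrite mulr1n; apply: eq_bigr => i _; rewrite mxE.
rewrite mulr0n big1// => i _; rewrite mxE.
have [ij|ij] := eqVneq (i : nat) j; last by rewrite Sd ?mul0r//; exact/eqP.
rewrite mulrC Sd ?mul0r// ij => /val_inj jk'.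
by rewrite jk' eqxx in jk.
Qed.

(** A column meets the diagonal at most once; when n > m, the columns beyond
    the diagonal do not meet it at all. *)
Lemma rdiag_col (F : nmodType) m n (S : 'M[F]_(m, n)) j : rdiag S ->
  (forall i, S i j = 0) \/ exists k, forall i, i != k -> S i j = 0.
Proof.
move=> Sd; have [jm|mj] := ltnP j m; [right|left].
  by exists (Ordinal jm) => i /eqP ij; apply: Sd => e; apply/ij/val_inj.
by move=> i; apply: Sd => e; have := ltn_ord i; rewrite e ltnNge mj.
Qed.

Lemma rdiag_col_sqrt (R : realType) m n (S : 'M[R]_(m, n)) j : rdiag S ->
  (forall i j, 0 <= S i j) ->
  Num.sqrt (\sum_i S i j ^+ 2) = \sum_i S i j.
Proof.
move=> /(rdiag_col j)[S0 _|[k Sk] S0].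
  by rewrite !big1 ?sqrtr0// => i _; rewrite S0 ?expr0n.
rewrite (bigD1 k)//= big1 ?addr0 => [|i ik]; last by rewrite Sk ?expr0n.
by rewrite sqrtr_sqr ger0_norm// (bigD1 k)//= big1 ?addr0.
Qed.

(** The Gram matrix of A is conjugate, by the orthogonal V, to the diagonal
    Gram matrix of S. All entries of S can be summed, the off-diagonal ones
    being zero. *)
Lemma nuclear_norm_svd (R : realType) m n (A : 'M[R]_(m, n)) U S V :
  is_svd A U S V -> nuclear_norm A = \sum_i \sum_j S i j.
Proof.
case=> -> UU VV Sd S0; rewrite exchange_big/=.
under [RHS]eq_bigr => j _ do rewrite -rdiag_col_sqrt//.
apply: nuclear_normE.
have -> : (U *m S *m V^T)^T *m (U *m S *m V^T) = V *m (S^T *m S) *m V^T.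
  by rewrite !trmx_mul trmxK !mulmxA -(mulmxA _ U^T U) UU mulmx1.
rewrite char_poly_conj ?(mulmx1C VV)// gram_rdiag// char_poly_diag.
by apply: eq_bigr => j _; rewrite mxE.
Qed.

Section TraceDuality.
Context {R : realType}.
Local Open Scope sesquilinear_scope.
Local Notation toC := (map_mx (real_complex R)).

Lemma map_toC_conj m n (A : 'M[R]_(m, n)) : (toC A) ^t* = toC A^T.
Proof.
apply/matrixP => i j; rewrite !mxE; apply: CrealP.
by apply/complex_realP; exists (A j i).
Qed.

(** An orthonormal eigenbasis of A^T A, as the conjugated rows of Q. It is taken
    over the complex numbers, but the eigenvalues l are real and nonnegative,
    so that the real characteristic polynomial splits and gives the singular
    values sqrt l of A. *)
Lemma gram_spectral m n (A : 'M[R]_(m, n)) :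
  exists (Q : 'M[R[i]]_n) (l : 'I_n -> R),
    [/\ Q \is unitarymx, forall j, 0 <= l j,
        Q *m toC (A^T *m A) *m Q^t* = diag_mx (\row_j (l j)%:C)%C &
        nuclear_norm A = \sum_j Num.sqrt (l j)].
Proof.
set G := toC (A^T *m A).
have Gherm : G \is hermsymmx.
  apply/is_hermitianmxP; rewrite expr0 scale1r map_toC_conj.
  by rewrite trmx_mul trmxK.
have Gnorm : G \is normalmx by exact: hermitian_normalmx.
pose Q := spectralmx G; have Qu : Q \is unitarymx := spectral_unitarymx G.
have /mxOverP dreal := hermitian_spectral_diag_real Gherm.
have Gdiag : Q *m G *m Q^t* = diag_mx (spectral_diag G).
  rewrite {1}(orthomx_spectralP Gnorm) -/Q !mulmxA mulmxV ?unitarymx_unit//.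
  by rewrite mul1mx mulmxtVK.
pose l j := complex.Re (spectral_diag G 0 j).
have ld : spectral_diag G = \row_j (l j)%:C%C.
  by apply/rowP => j; rewrite mxE /l RRe_real.
exists Q, l; rewrite Gdiag -ld; split => //.
  move=> j; rewrite -ler0c.
  have -> : (l j)%:C%C = (Q *m G *m Q^t*) j j.
    by rewrite Gdiag ld !mxE eqxx mulr1n.
  have -> : Q *m G *m Q^t* = (Q *m toC A^T) *m (Q *m toC A^T)^t*.
    by rewrite /G map_mxM trmx_mul map_mxM map_toC_conj trmxK !mulmxA.
  rewrite mxE sumr_ge0// => k _; rewrite !mxE.
  exact: mul_conjC_ge0.
apply: nuclear_normE.
apply: (map_poly_inj (real_complex R)).
rewrite map_char_poly -/G rmorph_prod/=.
under eq_bigr => j _ do rewrite map_polyXsubC.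
rewrite -(@char_poly_conj _ _ Q (Q^t*)) ?(unitarymxP _)//.
rewrite Gdiag ld char_poly_diag.
by apply: eq_bigr => j _; rewrite mxE.
Qed.

(** Half of the duality between the nuclear and the spectral norm: the
    hypotheses say that the singular values of P are at most t. With q_j the
    eigenbasis of D^T D, the rows of G and H below are the conjugates of P q_j
    and D q_j; they have norms at most t and exactly sqrt (l j), so
    Cauchy-Schwarz applied row by row gives the bound. *)
Lemma frob_inner_le_nuclear m n (P D : 'M[R]_(m, n)) (V : 'M[R]_n)
    (d : 'rV[R]_n) (t : R) :
  0 <= t -> V^T *m V = 1%:M -> P^T *m P = V *m diag_mx d *m V^T ->
  (forall j, d 0 j <= t ^+ 2) ->
  frob_inner P D <= t * nuclear_norm D.
Proof.
move=> t0 VV PP dt; have [Q [l [Qu l0 QD ->]]] := gram_spectral D.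
pose K := Q *m toC V; pose G := Q *m toC P^T; pose H := Q *m toC D^T.
have Ku : K *m K^t* = 1%:M.
  rewrite trmx_mul map_mxM map_toC_conj mulmxA -(mulmxA Q) -map_mxM.
  by rewrite (mulmx1C VV) map_mx1 mulmx1 (unitarymxP _).
have gramG j : dotmx (row j G) (row j G) <= (t ^+ 2)%:C%C.
  have -> : dotmx (row j G) (row j G) = (G *m G^t*) j j.
    by rewrite dotmxE !mxE; apply: eq_bigr => k _; rewrite !mxE.
  have -> : G *m G^t* = K *m diag_mx (toC d) *m K^t*.
    rewrite /G /K !trmx_mul !map_mxM !map_toC_conj trmxK -map_diag_mx.
    rewrite !mulmxA -!(mulmxA Q) -!map_mxM PP.
    by rewrite !map_mxM !mulmxA.
  (* t ^+ 2 is spread over row j of the unitary K, which has norm 1 *)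
  have -> : (t ^+ 2)%:C%C = \sum_k (t ^+ 2)%:C%C * (K j k * (K j k)^*).
    rewrite -mulr_sumr -[LHS]mulr1; congr (_ * _).
    move/matrixP: Ku => /(_ j j); rewrite !mxE eqxx => /esym Kjj.
    apply: etrans Kjj _.
    by apply: eq_bigr => k _; rewrite !mxE.
  rewrite mxE ler_sum// => k _; rewrite mul_mx_diag !mxE mulrAC.
  by rewrite mulrC ler_wpM2r ?mul_conjC_ge0// lecR dt.
have gramH j : dotmx (row j H) (row j H) = (l j)%:C%C.
  have -> : dotmx (row j H) (row j H) = (H *m H^t*) j j.
    by rewrite dotmxE !mxE; apply: eq_bigr => k _; rewrite !mxE.
  have -> : H *m H^t* = diag_mx (\row_j (l j)%:C)%C.
    by rewrite -QD /H trmx_mul map_mxM map_toC_conj trmxK map_mxM !mulmxA.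
  by rewrite !mxE eqxx mulr1n.
rewrite -lecR.
have innerGH : (frob_inner P D)%:C%C = \sum_j dotmx (row j G) (row j H).
  transitivity (\tr (G *m H^t*)).
    rewrite /frob_inner /G /H trmx_mul map_mxM map_toC_conj trmxK -mulmxA.
    rewrite [RHS]mxtrace_mulC -!mulmxA (mulmx1C (unitarymxP Qu)) mulmx1.
    by rewrite -map_mxM trace_map_mx.
  rewrite /mxtrace; apply: eq_bigr => j _.
  by rewrite dotmxE !mxE; apply: eq_bigr => k _; rewrite !mxE.
(* the summands are complex: only their sum is known to be real, so absolute
   values are taken before the sum is split *)
apply: le_trans (real_ler_norm _) _.
  by apply/complex_realP; exists (frob_inner P D).
rewrite innerGH; apply: le_trans (ler_norm_sum _ _ _) _.
rewrite mulr_sumr rmorph_sum/= ler_sum// => j _.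
have CS : `|dotmx (row j G) (row j H)| <=
    sqrtC (dotmx (row j G) (row j G)) * sqrtC (dotmx (row j H) (row j H)).
  exact: (CauchySchwarz_sqrt (@dotmx R[i] m)).
have sqrtC_toC (x : R) : 0 <= x -> sqrtC x%:C%C = (Num.sqrt x)%:C%C.
  move=> x0; rewrite -[in LHS](sqr_sqrtr x0) rmorphXn/= sqrCK//.
  by rewrite ler0c sqrtr_ge0.
apply: le_trans CS _; rewrite gramH sqrtC_toC// rmorphM/=.
rewrite ler_wpM2r ?ler0c ?sqrtr_ge0//.
have -> : t%:C%C = sqrtC (t ^+ 2)%:C%C.
  by rewrite sqrtC_toC ?sqr_ge0// sqrtr_sqr ger0_norm.
by rewrite ler_sqrtC ?gramG ?nnegrE ?ler0c ?sqr_ge0 ?(dnorm_ge0 (@dotmx R[i] m)).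
Qed.

End TraceDuality.

(** * Singular value thresholding *)

Section Thresholding.
Context {R : realType}.

Lemma soft_threshold_ger0 (t s : R) : 0 <= t -> 0 <= s ->
  soft_threshold t s = Num.max (s - t) 0.
Proof.
move=> t0; rewrite /soft_threshold le_eqVlt => /predU1P[<-|s0]; last first.
  by rewrite gtr0_sg// mul1r gtr0_norm.
by rewrite sgr0 mul0r sub0r max_r// oppr_le0.
Qed.

(** The residual A - D is U T V^T, where T holds the parts of the singular
    values that lie below the threshold, so its entries are in [0, t]; this
    bounds its norm and, by duality, its pairing with any B. The pairing with D
    itself attains the bound because T equals t wherever the thresholded factor
    does not vanish. The last two facts say that A - D is a subgradient of
    t |.|_* at D. *)
Lemma svt_residual m n (A D : 'M[R]_(m, n)) U S V (t : R) : 0 <= t ->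
  is_svd A U S V -> D = U *m map_mx (soft_threshold t) S *m V^T ->
  [/\ frob (A - D) <= Num.sqrt (m * n)%N%:R * t,
      frob_inner (A - D) D = t * nuclear_norm D &
      forall B, frob_inner (A - D) B <= t * nuclear_norm B].
Proof.
move=> t0 [Aeq UU VV Sd S0] Deq.
pose S' := map_mx (soft_threshold t) S; pose T := S - S'.
have S'E i j : S' i j = Num.max (S i j - t) 0.
  by rewrite mxE soft_threshold_ger0.
have T_bnd i j : 0 <= T i j <= t.
  rewrite !mxE soft_threshold_ger0//; have := S0 i j.
  by case: (leP (S i j - t) 0) => ? ?; apply/andP; split; lra.
have TS' i j : T i j * S' i j = t * S' i j.
  rewrite [T i j]mxE [(- S') i j]mxE S'E.
  by case: (leP (S i j - t) 0) => ?; rewrite ?mulr0//; congr (_ * _); lra.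
have Td : rdiag T.
  by move=> i j ij; rewrite !mxE Sd// /soft_threshold sgr0 mul0r subr0.
have S'd : rdiag S'.
  by move=> i j ij; rewrite !mxE Sd// /soft_threshold sgr0 mul0r.
have S'0 i j : 0 <= S' i j by rewrite S'E le_max lexx orbT.
have nucD : nuclear_norm D = \sum_i \sum_j S' i j.
  by apply: (@nuclear_norm_svd _ _ _ _ U S' V).
have ADE : A - D = U *m T *m V^T by rewrite Aeq Deq /T mulmxBr mulmxBl.
have inner_svd (M M' : 'M[R]_(m, n)) :
    frob_inner (U *m M *m V^T) (U *m M' *m V^T) = frob_inner M M'.
  rewrite frob_inner_mulmxr trmxK -!mulmxA VV mulmx1.
  by rewrite /frob_inner trmx_mul mulmxA -(mulmxA _ U^T) UU mulmx1.
split.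
- apply: frob_le; first by rewrite mulr_ge0 ?sqrtr_ge0.
  rewrite ADE inner_svd frob_innerE exprMn sqr_sqrtr ?ler0n// natrM.
  have -> : (m%:R * n%:R * t ^+ 2 : R) = \sum_(i < m) \sum_(j < n) t ^+ 2.
    rewrite !sumr_const !card_ord -[RHS]mulr_natl.
    by rewrite -[in RHS](mulr_natl (t ^+ 2)) mulrA.
  rewrite ler_sum// => i _; rewrite ler_sum// => j _.
  by case/andP: (T_bnd i j) => ? ?; rewrite -expr2 ler_sqr ?nnegrE.
- rewrite {2}Deq ADE inner_svd nucD frob_innerE mulr_sumr; apply: eq_bigr => i _.
  by rewrite mulr_sumr; apply: eq_bigr => j _; exact: TS'.
move=> B; pose d := \row_j \sum_i T i j ^+ 2.
apply: (@frob_inner_le_nuclear R m n (A - D) B V d t t0 VV).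
  rewrite -gram_rdiag// ADE !trmx_mul trmxK !mulmxA.
  by rewrite -(mulmxA _ U^T U) UU mulmx1.
move=> j; rewrite mxE.
have [T0|[k Tk]] := rdiag_col j Td.
  by rewrite big1 ?sqr_ge0// => i _; rewrite T0 expr0n.
rewrite (bigD1 k)//= big1 ?addr0 => [|i ik]; last by rewrite Tk ?expr0n.
by case/andP: (T_bnd k j) => ? ?; rewrite ler_sqr ?nnegrE.
Qed.

End Thresholding.

(** * Sequences with geometrically small increments *)

Section GeometricIncrements.
Context {R : realType}.

Lemma geometric_sum_le (q : R) k : 0 <= q < 1 ->
  \sum_(i < k) q ^+ i <= (1 - q)^-1.
Proof.
move=> /andP[q0 q1]; rewrite -[leRHS]mul1r ler_pdivlMr ?subr_gt0//.
have := subrX1 q k => qk.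
have -> : (\sum_(i < k) q ^+ i) * (1 - q) = 1 - q ^+ k by lra.
by rewrite lerBlDr lerDl exprn_ge0.
Qed.

Lemma geometric_increments_bounded (u : nat -> R) c q : 0 <= c -> 0 <= q < 1 ->
  (forall k, u k.+1 <= u k + c * q ^+ k) ->
  forall k, u k <= u 0%N + c / (1 - q).
Proof.
move=> c0 q01 uS k.
have : u k <= u 0%N + c * \sum_(i < k) q ^+ i.
  elim: k => [|k IH]; first by rewrite big_ord0 mulr0 addr0.
  by rewrite big_ord_recr/= mulrDr addrA (le_trans (uS k))// lerD2r.
by move/le_trans; apply; rewrite lerD2l ler_wpM2l// geometric_sum_le.
Qed.

(** Each factor 1 + x is at most exp x, so the product of the factors is at most
    the exponential of a geometric sum. *)
Lemma geometric_factors_bounded (u : nat -> R) c q : 0 <= c -> 0 <= q < 1 ->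
  (forall k, 0 <= u k) ->
  (forall k, u k.+1 <= (1 + c * q ^+ k) * u k) ->
  forall k, u k <= u 0%N * expR (c / (1 - q)).
Proof.
move=> c0 q01 u0 uS k.
have : u k <= u 0%N * expR (c * \sum_(i < k) q ^+ i).
  elim: k => [|k IH]; first by rewrite big_ord0 mulr0 expR0 mulr1.
  rewrite big_ord_recr/= mulrDr expRD mulrA (le_trans (uS k))// mulrC.
  rewrite ler_pM// ?expR_ge1Dx// addr_ge0// mulr_ge0// exprn_ge0//.
  by case/andP: q01.
move/le_trans; apply.
by rewrite ler_wpM2l// ler_expR ler_wpM2l// geometric_sum_le.
Qed.

(** Each entry is the sum of an absolutely convergent telescoping series. *)
Lemma geometric_increments_cvg m n (A : nat -> 'M[R]_(m, n)) c q :
  0 <= c -> 0 <= q < 1 ->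
  (forall k, frob (A k.+1 - A k) <= c * q ^+ k) ->
  exists Aoo : 'M[R]_(m, n), A @ \oo --> Aoo.
Proof.
move=> c0 /andP[q0 q1] AS.
have Aij i j : cvgn (fun k => A k i j).
  have : cvgn (series (telescope (fun k => A k i j))).
    apply: normed_cvg; apply: (@series_le_cvg _ _ (geometric c q)) => [k|k|k|].
    - exact: normr_ge0.
    - by rewrite /= mulr_ge0// exprn_ge0.
    - rewrite /= (le_trans _ (AS k))//.
      by have := normr_coef_le_frob (A k.+1 - A k) i j; rewrite !mxE.
    - by apply: is_cvg_geometric_series; rewrite ger0_norm.
  rewrite telescopeK => /cvg_ex[l cvl]; apply/cvg_ex; exists (l + A 0%N i j).
  rewrite (_ : (fun k => _) = (fun k => A k i j - A 0%N i j + A 0%N i j)).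
    exact: cvgD cvl (cvg_cst _).
  by apply/funext => k; rewrite subrK.
exists (\matrix_(i, j) lim ((fun k => A k i j) @ \oo)).
apply/cvg_mx_entourageP => E entE.
have H i j :
    \forall k \near \oo, (lim ((fun k => A k i j) @ \oo), A k i j) \in E.
  have /cvg_entourageP/(_ _ entE) Ek := Aij i j.
  by near=> k; apply: mem_set; near: k.
apply: filter_forall => i; apply: filter_forall => j.
rewrite mxE; exact: H.
Unshelve. all: by end_near. Qed.

(** Decomposing A over the standard basis bounds N A by the sum of the
    `|A i j| * N (delta_mx i j), and each `|A i j| is at most frob A. *)
Lemma norm_le_frob m n (N : 'M[R]_(m, n) -> R) : is_norm N ->
  exists2 K, 0 <= K & forall A, N A <= K * frob A.
Proof.
case=> Ntri Nscale _.
have N0 : N 0 = 0 by rewrite -(scale0r (0 : 'M[R]_(m, n))) Nscale normr0 mul0r.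
have NN A : N (- A) = N A by rewrite -scaleN1r Nscale normrN1 mul1r.
have Nge0 A : 0 <= N A.
  by have := Ntri A (- A); rewrite subrr N0 NN -mulr2n pmulrn_lge0.
have Nsum (I : finType) (F : I -> 'M[R]_(m, n)) : N (\sum_i F i) <= \sum_i N (F i).
  elim/big_rec2: _ => [|i y B _ By]; first by rewrite N0.
  by rewrite (le_trans (Ntri _ _))// lerD2l.
exists (\sum_i \sum_j N (delta_mx i j)).
  by rewrite sumr_ge0// => i _; rewrite sumr_ge0.
move=> A; have -> : N A = N (\sum_i \sum_j A i j *: delta_mx i j).
  by rewrite -matrix_sum_delta.
rewrite mulr_suml.
apply: le_trans (Nsum _ _) _; rewrite ler_sum// => i _.
rewrite mulr_suml; apply: le_trans (Nsum _ _) _; rewrite ler_sum// => j _.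
by rewrite Nscale mulrC ler_wpM2l// normr_coef_le_frob.
Qed.

End GeometricIncrements.

(** * The resolvent of the C-update *)

Lemma resolvent_mul (R : realType) m n (E : 'M[R]_n) mu (Z : 'M[R]_(m, n)) :
  Z *m (1%:M + mu *: (E *m E^T)) = Z + mu *: (Z *m E *m E^T).
Proof. by rewrite mulmxDr mulmx1 -scalemxAr mulmxA. Qed.

(** Let E be the inverse of W and B = Z (I + mu E E^T). Pairing B with Z gives
    |Z|^2 + mu |Z E|^2 <= |Z| |B|, and |Z| = |Z E W| <= |Z E| |W|. The factor
    mu on the left is what makes the increments of C summable. *)
Lemma frob_resolvent (R : realType) m n (W : 'M[R]_n) (mu : R)
    (Z : 'M[R]_(m, n)) :
  W \in unitmx -> 0 < mu ->
  mu * frob Z <=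
    frob W ^+ 2 * frob (Z *m (1%:M + mu *: (invmx W *m (invmx W)^T))).
Proof.
move=> Wu mu0; set E := invmx W; set B := Z *m _.
have ZB : frob Z ^+ 2 + mu * frob (Z *m E) ^+ 2 <= frob Z * frob B.
  apply: le_trans (frob_inner_le _ _).
  rewrite /B resolvent_mul frob_innerDr frob_innerZr !sqr_frob.
  by rewrite -frob_inner_mulmxr.
have ZE : frob Z ^+ 2 <= frob (Z *m E) ^+ 2 * frob W ^+ 2.
  rewrite -exprMn ler_sqr ?nnegrE ?mulr_ge0 ?frob_ge0//.
  by rewrite -[Z in leLHS](mulmxKV Wu) frobM.
have [Z0|Z0] := eqVneq (frob Z) 0.
  by rewrite Z0 mulr0 mulr_ge0 ?sqr_ge0 ?frob_ge0.
have Zgt0 : 0 < frob Z by rewrite lt_neqAle eq_sym Z0 frob_ge0.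
rewrite -(ler_pM2r Zgt0).
have W0 := sqr_ge0 (frob W).
have h1 : mu * frob Z ^+ 2 <= (mu * frob (Z *m E) ^+ 2) * frob W ^+ 2.
  by rewrite -mulrA ler_wpM2l// ltW.
have h2 : (mu * frob (Z *m E) ^+ 2) * frob W ^+ 2 <=
    (frob Z * frob B) * frob W ^+ 2.
  by rewrite ler_wpM2r// (le_trans _ ZB)// lerDr sqr_ge0.
lra.
Qed.

Lemma invmx_gram (R : comUnitRingType) n (W : 'M[R]_n) : W \in unitmx ->
  invmx (W^T *m W) = invmx W *m (invmx W)^T.
Proof.
move=> Wu; have Gu : W^T *m W \in unitmx by rewrite unitmx_mul unitmx_tr Wu.
have GE : W^T *m W *m (invmx W *m (invmx W)^T) = 1%:M.
  by rewrite -mulmxA (mulmxA W) mulmxV// mul1mx -trmx_mul mulVmx// trmx1.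
by rewrite -[LHS]mulmx1 -GE mulKmx.
Qed.

(** By [frob_resolvent] on row vectors, the kernel of I + mu E E^T is trivial. *)
Lemma resolvent_unit (R : realType) n (W : 'M[R]_n) (mu : R) :
  W \in unitmx -> 0 < mu ->
  1%:M + mu *: (invmx W *m (invmx W)^T) \in unitmx.
Proof.
move=> Wu mu0; rewrite -row_free_unit; apply: inj_row_free => v vM.
apply: frob_eq0; apply/eqP; rewrite eq_le frob_ge0 andbT -(pmulr_rle0 _ mu0).
have := frob_resolvent v Wu mu0; rewrite vM.
by rewrite frob0 mulr0.
Qed.

(** * The two partial minimizations *)

Section Minimizers.
Context {R : realType} {m n : nat}.
Implicit Types (X C D Y : 'M[R]_(m, n)) (W : 'M[R]_n).

(** The closed form of C' says that the gradient vanishes there ([stat]). At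
    C = C' + G the linear term in G therefore drops out, and what remains is
    (1/2) |G|^2 + (mu/2) |G E|^2. *)
Lemma aug_lagrangian_minC X W (tau : R) C' C D Y (mu : R) :
  W \in unitmx -> 0 < mu ->
  C' = (X *m W + mu *: (D *m (invmx W)^T) + Y *m (invmx W)^T)
    *m invmx (1%:M + mu *: invmx (W^T *m W)) ->
  aug_lagrangian X W tau C' D Y mu <= aug_lagrangian X W tau C D Y mu.
Proof.
move=> Wu mu0 C'E; set E := invmx W in C'E *.
have stat : X *m W - C' + Y *m E^T + mu *: ((D - C' *m E) *m E^T) = 0.
  have : C' *m (1%:M + mu *: (E *m E^T)) = X *m W + mu *: (D *m E^T) + Y *m E^T.
    by rewrite C'E invmx_gram// mulmxKV// resolvent_unit.
  rewrite resolvent_mul mulmxBl scalerBr; move: (mu *: _) (mu *: _) => A B.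
  move=> /eqP; rewrite -subr_eq0 => /eqP CB; rewrite -oppr0 -CB.
  by apply/matrixP => i j; rewrite !mxE; ring.
pose G := C - C'; have CE : C = C' + G by rewrite /G addrC subrK.
set P := X *m W - C' in stat; set Q := D - C' *m E in stat.
have PG : X *m W - C = P - G by rewrite CE opprD addrA.
have QG : D - C *m E = Q - G *m E by rewrite CE mulmxDl opprD addrA.
have innerG : frob_inner P G + frob_inner Y (G *m E)
    + mu * frob_inner Q (G *m E) = 0.
  rewrite !(frob_innerC _ (G *m E)) !frob_inner_mulmxr !(frob_innerC G).
  rewrite -frob_innerZl -!frob_innerDl stat.
  by rewrite /frob_inner trmx0 mul0mx linear0.
rewrite /aug_lagrangian -/E PG QG -/P -/Q.
(* keeps the rewriting rules below from looking inside P and Q *)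
clearbody P Q.
rewrite (sqr_frobD P) (sqr_frobD Q) (frobN G) (frobN (G *m E)).
rewrite (frob_innerNr G) (frob_innerNr _ Q) frob_innerDr (frob_innerNr _ Y).
have := sqr_ge0 (frob G); have := mulr_ge0 (ltW mu0) (sqr_ge0 (frob (G *m E))).
lra.
Qed.

(** Write d = D' - D and E = C W^-1. The subgradient property of A - D' gives
    tau |D'|_* - tau |D|_* <= mu <A - D', d>, and
    mu (A - D') = - Y - mu (D' - E). Completing the square, the change of the
    terms in Y and mu is - mu <A - D', d> - (mu/2) |d|^2. *)
Lemma aug_lagrangian_minD X W (tau : R) C D' D Y (mu : R) U S V :
  0 <= tau -> 0 < mu ->
  is_svd (C *m invmx W - mu^-1 *: Y) U S V ->
  D' = U *m map_mx (soft_threshold (tau / mu)) S *m V^T ->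
  aug_lagrangian X W tau C D' Y mu <= aug_lagrangian X W tau C D Y mu.
Proof.
move=> tau0 mu0; rewrite /aug_lagrangian; move: (C *m invmx W) => E.
set A := E - mu^-1 *: Y => svdA D'E.
have [_ innerD' innerD] := svt_residual (divr_ge0 tau0 (ltW mu0)) svdA D'E.
have AE : A = E - mu^-1 *: Y by [].
clearbody A.
have sub : tau * nuclear_norm D' - tau * nuclear_norm D <=
    mu * frob_inner (A - D') (D' - D).
  rewrite frob_innerDr frob_innerNr innerD'.
  have mut : mu * (tau / mu) = tau by rewrite mulrC divfK ?gt_eqF.
  have := ler_wpM2l (ltW mu0) (innerD D).
  by rewrite mulrBr !(mulrA mu (tau / mu)) mut; lra.
have D'Esplit : D' - E = (D' - D) + (D - E) by rewrite addrA subrK.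
have AD' : A - D' = - (mu^-1 *: Y) - (D - E) - (D' - D).
  by rewrite AE; apply/matrixP => i j; rewrite !mxE; ring.
move: sub; rewrite D'Esplit AD'; move: (D' - D) (D - E) => d e.
rewrite 2!frob_innerDl !frob_innerNl frob_innerZl -sqr_frob.
rewrite 2!mulrDr !mulrN mulVKf ?gt_eqF// frob_innerDr sqr_frobD.
rewrite (frob_innerC d e).
have := mulr_ge0 (ltW mu0) (sqr_ge0 (frob d)).
lra.
Qed.

End Minimizers.

(** * The iteration *)

Section Iteration.
Context {R : realType} {m n : nat} (X : 'M[R]_(m, n)) (W : 'M[R]_n).
Context (tau rho mu0 : R) (C D Y : nat -> 'M[R]_(m, n)) (mu : nat -> R).
Context (W_unit : W \in unitmx) (tau_gt0 : 0 < tau) (rho_gt1 : 1 < rho).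
Context (mu0_gt0 : 0 < mu0) (Hwsvt : wsvt X W tau rho mu0 C D Y mu).

Local Notation E := (invmx W).
Local Notation r k := (D k - C k *m E).
Local Notation q := (rho^-1).
Local Notation L k := (aug_lagrangian X W tau (C k) (D k) (Y k.-1) (mu k.-1)).

Lemma mu_gt0 k : 0 < mu k.
Proof.
elim: k => [|k IH]; first by rewrite (wsvt_mu0 Hwsvt).
by rewrite (wsvt_muS Hwsvt) mulr_gt0// (lt_trans ltr01).
Qed.

Lemma inv_muE k : (mu k)^-1 = mu0^-1 * q ^+ k.
Proof.
elim: k => [|k IH]; first by rewrite (wsvt_mu0 Hwsvt) mulr1.
by rewrite (wsvt_muS Hwsvt) invfM IH mulrCA exprS.
Qed.

Lemma q_itv : 0 <= q < 1.
Proof.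
have rho0 : 0 < rho by exact: lt_trans rho_gt1.
by rewrite invr_ge0 invf_lt1// rho_gt1 ltW.
Qed.

Lemma mu_le k : mu k <= mu k.+1.
Proof. by rewrite (wsvt_muS Hwsvt) ler_peMl ?ltW// mu_gt0. Qed.

Definition dual_bound := Num.sqrt (m * n)%N%:R * tau.

Lemma dual_bound_ge0 : 0 <= dual_bound.
Proof. by rewrite mulr_ge0 ?sqrtr_ge0// ltW. Qed.

(** Up to sign, Y k.+1 is mu k times the residual of a thresholding at
    tau / mu k, so the powers of mu cancel and no bound on C is needed. *)
Lemma frob_Y_le k : frob (Y k) <= dual_bound.
Proof.
case: k => [|k]; first by rewrite (wsvt_Y0 Hwsvt) frob0 dual_bound_ge0.
have [U [S [V [svdA DE]]]] := wsvt_DS Hwsvt k.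
have muk := mu_gt0 k.
have [residual _ _] := svt_residual (divr_ge0 (ltW tau_gt0) (ltW muk)) svdA DE.
have -> : Y k.+1 = - (mu k *: (C k.+1 *m E - (mu k)^-1 *: Y k - D k.+1)).
  rewrite addrAC scalerBr scalerA mulfV ?gt_eqF// scale1r opprB.
  by rewrite -scalerN opprB (wsvt_YS Hwsvt).
rewrite frobN frobZ gtr0_norm// mulrC -ler_pdivlMr//.
by rewrite (le_trans residual)// mulrA.
Qed.

(** The factor rho is there because the gap at step k.+1 is controlled by
    1 / mu k = rho / mu k.+1. *)
Definition gap_const := 2 * rho * dual_bound.

Lemma gap_const_ge0 : 0 <= gap_const.
Proof. by rewrite !mulr_ge0 ?dual_bound_ge0// ltW// (lt_trans ltr01). Qed.

(** The gap is a difference of two bounded multipliers divided by mu; at step 0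
    it vanishes by the initialization. *)
Lemma frob_gap_le k : frob (r k) <= gap_const / mu k.
Proof.
case: k => [|k].
  rewrite (wsvt_C0 Hwsvt) (wsvt_D0 Hwsvt) mulmxK// subrr frob0.
  by rewrite divr_ge0 ?gap_const_ge0// ltW// mu_gt0.
have muk := mu_gt0 k; have rho0 : 0 < rho by exact: lt_trans rho_gt1.
have -> : r k.+1 = (mu k)^-1 *: (Y k.+1 - Y k).
  by rewrite (wsvt_YS Hwsvt) addrAC subrr add0r scalerA mulVf ?gt_eqF// scale1r.
rewrite frobZ gtr0_norm ?invr_gt0//.
have -> : gap_const / mu k.+1 = (mu k)^-1 * (dual_bound + dual_bound).
  by rewrite /gap_const (wsvt_muS Hwsvt); field; rewrite !gt_eqF.
rewrite ler_wpM2l ?invr_ge0 ?(ltW muk)// (le_trans (frobD _ _))// frobN.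
by rewrite lerD// frob_Y_le.
Qed.

(** Centring the update at C k leaves, on the right, the penalty multiplying
    only the gap, which is O(1 / mu k). *)
Lemma C_increment k :
  (C k.+1 - C k) *m (1%:M + mu k *: (E *m E^T)) =
  X *m W + Y k *m E^T + mu k *: (r k *m E^T) - C k.
Proof.
rewrite mulmxBl (wsvt_CS Hwsvt) invmx_gram// mulmxKV; last first.
  by rewrite resolvent_unit// mu_gt0.
rewrite resolvent_mul mulmxBl scalerBr.
move: (mu k *: (D k *m _)) (mu k *: (C k *m _ *m _)) => A B.
by apply/matrixP => i j; rewrite ![in LHS]mxE ![in RHS]mxE; ring.
Qed.

(** Bounds the terms other than C k on the right of [C_increment]. *)
Definition drift_const :=
  frob (X *m W) + dual_bound * frob E^T + gap_const * frob E^T.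

Lemma drift_const_ge0 : 0 <= drift_const.
Proof.
rewrite /drift_const !addr_ge0 ?frob_ge0//.
  by rewrite mulr_ge0 ?frob_ge0 ?dual_bound_ge0.
by rewrite mulr_ge0 ?frob_ge0 ?gap_const_ge0.
Qed.

Lemma frob_C_increment_le k :
  frob (C k.+1 - C k) <= frob W ^+ 2 / mu k * (frob (C k) + drift_const).
Proof.
have muk := mu_gt0 k.
rewrite mulrAC ler_pdivlMr// mulrC.
apply: le_trans (frob_resolvent _ W_unit muk) _; rewrite ler_wpM2l ?sqr_ge0//.
rewrite C_increment (le_trans (frobD _ _))// frobN addrC lerD2l.
apply: le_trans (frobD _ _) _; apply: lerD.
  apply: le_trans (frobD _ _) _; rewrite lerD2l (le_trans (frobM _ _))//.
  by rewrite ler_wpM2r ?frob_ge0 ?frob_Y_le.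
rewrite frobZ gtr0_norm// (le_trans (ler_wpM2l (ltW muk) (frobM _ _)))//.
by rewrite mulrA ler_wpM2r ?frob_ge0// mulrC -ler_pdivlMr// frob_gap_le.
Qed.

(** [frob_C_increment_le] bounds the increment by a geometric factor times a
    quantity that grows with C; that quantity, u below, satisfies
    u k.+1 <= (1 + a q^k) u k and is hence bounded. *)
Lemma geometric_C_increment :
  exists2 c, 0 <= c & forall k, frob (C k.+1 - C k) <= c * q ^+ k.
Proof.
pose u k := frob (C k) + drift_const.
pose a := frob W ^+ 2 / mu0.
have a0 : 0 <= a by rewrite divr_ge0 ?sqr_ge0// ltW.
have u0 k : 0 <= u k by rewrite addr_ge0 ?frob_ge0 ?drift_const_ge0.
have incr k : frob (C k.+1 - C k) <= a * q ^+ k * u k.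
  by rewrite /a -(mulrA _ mu0^-1) -inv_muE frob_C_increment_le.
have uS k : u k.+1 <= (1 + a * q ^+ k) * u k.
  rewrite mulrDl mul1r {1}/u -[C k.+1](subrK (C k)).
  have := frobD (C k.+1 - C k) (C k); have := incr k; rewrite {2}/u; lra.
have uM := geometric_factors_bounded a0 q_itv u0 uS.
set M := u 0%N * _ in uM.
have M0 : 0 <= M by rewrite mulr_ge0 ?expR_ge0.
exists (a * M); first exact: mulr_ge0.
move=> k; rewrite (le_trans (incr k))// mulrAC ler_wpM2r ?ler_wpM2l//.
by rewrite exprn_ge0//; case/andP: q_itv.
Qed.

Lemma C_cvg : exists Coo : 'M[R]_(m, n), C @ \oo --> Coo.
Proof.
have [c c0 cC] := geometric_C_increment.
exact: geometric_increments_cvg c0 q_itv cC.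
Qed.

(** The increments of D = C E + r are those of C times E plus those of the gap,
    and the gap is itself geometrically small. *)
Lemma D_cvg : exists Doo : 'M[R]_(m, n), D @ \oo --> Doo.
Proof.
have [c c0 cC] := geometric_C_increment.
apply: (@geometric_increments_cvg _ _ _ D
  (gap_const / mu0 + gap_const / mu0 + c * frob E) q).
- have g0 : 0 <= gap_const / mu0 by rewrite divr_ge0 ?gap_const_ge0// ltW.
  by rewrite addr_ge0 ?mulr_ge0 ?frob_ge0// addr_ge0.
- exact: q_itv.
move=> k.
have -> : D k.+1 - D k = r k.+1 - r k + (C k.+1 - C k) *m E.
  rewrite mulmxBl; apply/matrixP => i j.
  by rewrite ![in LHS]mxE ![in RHS]mxE; ring.
rewrite !mulrDl -!(mulrA gap_const) -inv_muE.
apply: le_trans (frobD _ _) _; apply: lerD; last first.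
  apply: le_trans (frobM _ _) _.
  by rewrite mulrAC ler_wpM2r ?frob_ge0.
apply: le_trans (frobD _ _) _; rewrite frobN; apply: lerD; last exact: frob_gap_le.
apply: le_trans (frob_gap_le _) _.
by rewrite ler_wpM2l ?gap_const_ge0// lef_pV2 ?posrE ?mu_gt0 ?mu_le.
Qed.

Lemma lagrangian_increment_le k : (1 <= k)%N ->
  L k.+1 - L k <= (mu k + mu k.-1) / 2 * frob (r k) ^+ 2.
Proof.
case: k => // k _ /=; set j := k.+1.
have muj := mu_gt0 j; have muk := mu_gt0 k.
have [U [S [V [svdA DE]]]] := wsvt_DS Hwsvt j.
have LD := aug_lagrangian_minD X (D j) (ltW tau_gt0) muj svdA DE.
have LC := aug_lagrangian_minC tau (C j) W_unit muj (wsvt_CS Hwsvt j).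
rewrite lerBlDr (le_trans LD)// (le_trans LC)//.
(* passing from the multiplier Y k to Y j = Y k + mu k *: r j and from the
   penalty mu k to mu j changes L by (mu k + (mu j - mu k) / 2) * |r j| ^ 2 *)
rewrite /aug_lagrangian (wsvt_YS Hwsvt k) -/j frob_innerDl frob_innerZl -sqr_frob.
lra.
Qed.

Lemma increment_bound_le : exists2 c, 0 <= c & forall k, (1 <= k)%N ->
  `|(mu k + mu k.-1) / 2 * frob (r k) ^+ 2| <= c / mu k.
Proof.
exists (gap_const ^+ 2); first exact: sqr_ge0.
case=> // k _ /=; have muk := mu_gt0 k; have muj := mu_gt0 k.+1.
rewrite ger0_norm; last by rewrite mulr_ge0 ?sqr_ge0// divr_ge0 ?addr_ge0// ltW.
apply: (@le_trans _ _ (mu k.+1 * (gap_const / mu k.+1) ^+ 2)); last first.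
  by rewrite le_eqVlt; apply/orP; left; apply/eqP; field; rewrite gt_eqF.
rewrite ler_pM ?sqr_ge0//.
- by rewrite divr_ge0 ?addr_ge0// ltW.
- by have := mu_le k; lra.
rewrite ler_sqr ?nnegrE ?frob_ge0 ?frob_gap_le//.
exact: le_trans (frob_ge0 _) (frob_gap_le _).
Qed.

Lemma lagrangian_bounded : exists M, forall k, (1 <= k)%N -> L k <= M.
Proof.
have [c c0 cL] := increment_bound_le.
pose u k := L k.+1.
have uS k : u k.+1 <= u k + c / mu0 * q ^+ k.
  rewrite -mulrA -inv_muE addrC -lerBlDr.
  rewrite (le_trans (@lagrangian_increment_le k.+1 isT))//.
  rewrite (le_trans (ler_norm _))// (le_trans (cL k.+1 isT))//.
  by rewrite ler_wpM2l// lef_pV2 ?posrE ?mu_gt0 ?mu_le.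
have := geometric_increments_bounded (divr_ge0 c0 (ltW mu0_gt0)) q_itv uS.
move=> uM; exists (u 0%N + c / mu0 / (1 - q)).
by case=> // k _; exact: uM.
Qed.

End Iteration.

Unset Implicit Arguments.
Set Strict Implicit.

Theorem theorem1 (R : realType) (m n : nat)
    (X : 'M[R]_(m, n)) (W : 'M[R]_n) (tau rho mu0 : R)
    (C D Y : nat -> 'M[R]_(m, n)) (mu : nat -> R)
    (N : 'M[R]_(m, n) -> R)
    (W_unit : W \in unitmx) (tau_gt0 : 0 < tau) (rho_gt1 : 1 < rho)
    (mu0_gt0 : 0 < mu0)
    (HN : is_norm N)
    (Hwsvt : wsvt X W tau rho mu0 C D Y mu) :
  let r (k : nat) : 'M[R]_(m, n) := D k - C k *m invmx W in
  (* L k is only meaningful for k >= 1 *)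
  let L (k : nat) : R := aug_lagrangian X W tau (C k) (D k) (Y k.-1) (mu k.-1) in
  let bound (k : nat) : R := (mu k + mu k.-1) / 2 * frob (r k) ^+ 2 in
  ((exists Coo : 'M[R]_(m, n), C @ \oo --> Coo) /\
   (exists Doo : 'M[R]_(m, n), D @ \oo --> Doo) /\
   (exists c : R, forall k : nat, (1 <= k)%N -> N (r k) <= c / mu k)) /\
  ((exists M : R, forall k : nat, (1 <= k)%N -> L k <= M) /\
   (forall k : nat, (1 <= k)%N -> L k.+1 - L k <= bound k) /\
   (exists c : R, forall k : nat, (1 <= k)%N -> `|bound k| <= c / mu k)).
Proof.
split; split; [|split | |split].
- exact: (C_cvg W_unit tau_gt0 rho_gt1 mu0_gt0 Hwsvt).
- exact: (D_cvg W_unit tau_gt0 rho_gt1 mu0_gt0 Hwsvt).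
- have [K K0 NK] := norm_le_frob HN.
  exists (K * @gap_const R m n tau rho) => k _; rewrite (le_trans (NK _))// -mulrA.
  by rewrite ler_wpM2l// (frob_gap_le W_unit tau_gt0 rho_gt1 mu0_gt0 Hwsvt).
- exact: (lagrangian_bounded W_unit tau_gt0 rho_gt1 mu0_gt0 Hwsvt).
- exact: (lagrangian_increment_le W_unit tau_gt0 rho_gt1 mu0_gt0 Hwsvt).
- have [c _ cL] := increment_bound_le W_unit tau_gt0 rho_gt1 mu0_gt0 Hwsvt.
  by exists c.
Qed.
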